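(* Let $X$ be the set of $13$ points of $\mathbf{P}^2(\mathbf{R})$ determined by the vertices, face centers and edge centers of a regular octahedron centered at the origin of $\mathbf{R}^3$ ($3$, $4$ and $6$ points respectively), and let $X^*$ be the set of their $13$ dual lines. Equivalently, in suitable coordinates, $X$ consists of the points $(x_1:x_2:x_3)$ determined by the $26$ nonzero vectors $(x_1,x_2,x_3)\in\mathbf{Z}^3$ with each $|x_i|\le 1$, and $X^*$ consists of the lines $x_1y_1+x_2y_2+x_3y_3=0$ with $(y_1,y_2,y_3)\neq 0$ and each $y_i\in\{-1,0,1\}$. Then there are exactly $48$ incidences between points of $X$ and lines of $X^*$. Moreover, reduction of these coordinates modulo $3$ gives bijections from $X$ and $X^*$ to the points and lines of the finite projective plane $\mathbf{P}^2(\mathbf{F}_3)$ of order $3$, mapping the $48$ incidences to incidences, and the only other incidences among the $52$ incidences of $\mathbf{P}^2(\mathbf{F}_3)$ are the four between each face point $(\pm1:\pm1:\pm1)$ and its dual line.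
   Context: Each nonzero vector of $\mathbf{R}^3$ determines a point of $\mathbf{P}^2(\mathbf{R})$, namely the line through the origin that it spans; antipodal vectors determine the same point. The dual line of the point $(y_1:y_2:y_3)$ is the line $\{(x_1:x_2:x_3) : x_1y_1+x_2y_2+x_3y_3=0\}$. An incidence is a pair (point, line) with the point on the line. The face points are the four points of $X$ determined by the face centers of the octahedron, i.e. those with all three coordinates nonzero. *)

(* Defs.v *)
From HB Require Import structures.
From mathcomp Require Import all_boot all_order all_algebra.
From mathcomp Require Import all_classical all_reals.

Set Implicit Arguments.
Unset Strict Implicit.
Unset Printing Implicit Defensive.

Import Order.TTheory GRing.Theory Num.Theory.

Local Open Scope classical_set_scope.
Local Open Scope ring_scope.

(* The projective plane P^2(F): points and lines are the subspaces of F^3 of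
   dimension 1 and 2, and incidence is inclusion.  The point determined by a
   nonzero vector v is <[v]>%VS. *)
Section ProjectivePlane.
Variable F : fieldType.
Implicit Types (X L : set {vspace 'rV[F]_3}) (y : 'rV[F]_3).

Definition proj_points : set {vspace 'rV[F]_3} := [set U | \dim U = 1%N].

Definition proj_lines : set {vspace 'rV[F]_3} := [set U | \dim U = 2%N].

Definition points_of (D : set 'rV[F]_3) : set {vspace 'rV[F]_3} :=
  [set <[v]>%VS | v in D].

(* {x | x_1 y_1 + x_2 y_2 + x_3 y_3 = 0}, a projective line when y != 0 *)
Definition dual_line y : {vspace 'rV[F]_3} := lker (linfun (mulmxr y^T)).

Definition dual_lines X : set {vspace 'rV[F]_3} :=
  [set dual_line y | y in [set y | y != 0 /\ X <[y]>%VS]].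

Definition incidences X L : set ({vspace 'rV[F]_3} * {vspace 'rV[F]_3}) :=
  [set pl | [/\ X pl.1, L pl.2 & (pl.1 <= pl.2)%VS]].

(* the action of the linear change of coordinates u |-> u *m T on subspaces *)
Definition change_coords (T : 'M[F]_3) (U : {vspace 'rV[F]_3}) :
  {vspace 'rV[F]_3} := (linfun (mulmxr T) @: U)%VS.

End ProjectivePlane.

Section Octahedron.
Variable R : realType.
Implicit Types (V S : set 'rV[R]_3) (T : 'M[R]_3).

(* the linear map u |-> u *m T multiplies all lengths by sqrt s *)
Definition is_similarity T := exists2 s : R, 0 < s & T *m T^T = s%:M.

(* V is the vertex set of a regular octahedron centered at the origin: the
   image under a linear similarity of the six vectors +-e_1, +-e_2, +-e_3 *)
Definition centered_regular_octahedron V :=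
  exists2 A : 'M[R]_3, is_similarity A &
    V = [set v | exists i : 'I_3, v = row i A \/ v = - row i A].

(* S is the set of vertices on a face (of any dimension) of the convex hull
   of V, i.e. the set of points of V on some supporting plane c . v = m *)
Definition spans_face V S :=
  exists (c : 'rV[R]_3) (m : R),
    (forall v, V v -> (v *m c^T) 0 0 <= m) /\
    S = [set v | V v /\ (v *m c^T) 0 0 = m].

Definition edge_centers V : set 'rV[R]_3 :=
  [set x | exists u v, [/\ u != v, spans_face V [set u; v] &
     x = 2^-1 *: (u + v)]].

(* centroids of the triangular faces *)
Definition face_centers V : set 'rV[R]_3 :=
  [set x | exists u v w, [/\ uniq [:: u; v; w],
     spans_face V [set u; v; w] & x = 3^-1 *: (u + v + w)]].

Definition octahedron_points V : set {vspace 'rV[R]_3} :=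
  points_of (V `|` face_centers V `|` edge_centers V).

End Octahedron.

Definition cube_vectors : set 'rV[int]_3 :=
  [set x | x != 0 /\ forall i, `|x 0 i| <= 1].

(* integer coordinates read in F; for F = 'F_3 this is reduction modulo 3 *)
Definition coords_in (F : fieldType) (x : 'rV[int]_3) : 'rV[F]_3 :=
  map_mx (intr : int -> F) x.

(* Main.v *)
Require Import Defs.
From HB Require Import structures.
From mathcomp Require Import all_boot all_order all_algebra.
From mathcomp Require Import all_classical all_reals.

Set Implicit Arguments.
Unset Strict Implicit.
Unset Printing Implicit Defensive.

Import Order.TTheory GRing.Theory Num.Theory.

Local Open Scope card_scope.
Local Open Scope classical_set_scope.
Local Open Scope ring_scope.

(** Write [A] for the matrix whose rows [a_1, a_2, a_3] and their opposites are
    the vertices of the octahedron.  Since [A *m A^T = s%:M], the scalar product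
    of two vectors with coordinates [t] and [t'] in the basis of the rows is
    [s] times the scalar product of [t] and [t'].  So everything reduces to
    integer triples with entries in {-1, 0, 1}, once the centers of the faces
    are known.  A face is cut out by a supporting plane [c . v = m], and it
    contains no two antipodal vertices: otherwise [m = 0], then [c = 0] on all
    the vertices and the face would contain all six of them
    ([face_no_antipodes]).  Hence edges and triangles are obtained by choosing
    a sign for two or three of the axes; conversely the plane orthogonal to a
    triple [x] supports the face spanned by the vertices [t] with [t . x = 1].
    Edge and face centers are therefore proportional to the triples with two
    and three nonzero entries ([edge_centersE], [face_centersE]).

    Two such triples determine the same point over any field of characteristic
    other than 2 exactly when they are opposite ([fpoint_eq_sign]).  This
    applies both to [R] and to ['F_3], so the 13 triples up to sign label the
    points and (by duality, [dual_line_eq]) the lines on both sides, and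
    reduction modulo 3 is the bijection preserving labels.  It is onto because
    {-1, 0, 1} represents every residue modulo 3 and every projective line is
    the dual of some vector ([fvec_F3_surj], [dual_line_surj]).

    The point [t] is on the line [t'] over [R] when [t . t' = 0] and over ['F_3]
    when 3 divides [t . t'] ([incidences_frame]).  As [t . t'] is at most 3 in
    absolute value, with equality only for [t' = t] or [t' = - t] having no zero
    entry, the additional incidences modulo 3 are those of the four face points
    with their own duals ([flags_diff], [extra_incidences]).  The cardinalities
    are counts in explicit lists of triples. *)

(** * Points and lines of a projective plane *)

Lemma vlineZ (F : fieldType) (vT : vectType F) (c : F) (v : vT) :
  c != 0 -> <[c *: v]>%VS = <[v]>%VS.
Proof.
move=> c0; apply/eqP; rewrite eqEdim !dim_vline scaler_eq0 (negPf c0) leqnn andbT.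
by rewrite -memvE memvZ ?memv_line.
Qed.

Lemma vline_eqP (F : fieldType) (vT : vectType F) (u v : vT) : v != 0 ->
  reflect (exists2 c, c != 0 & u = c *: v) (<[u]>%VS == <[v]>%VS).
Proof.
move=> v0; apply: (iffP eqP) => [uv|[c c0 ->]].
  have /vlineP[c uE] : u \in <[v]>%VS by rewrite -uv memv_line.
  exists c => //; apply: contraNneq v0 => c0.
  have := dim_vline v; rewrite -uv dim_vline uE c0 scale0r eqxx.
  by case: (v == 0).
exact: vlineZ.
Qed.

Lemma rowN0 (V : nmodType) n (y : 'rV[V]_n) : y != 0 -> exists i, y 0 i != 0.
Proof.
move=> y0; apply/existsP; apply: contraNT y0 => /existsPn y0.
by apply/eqP/rowP => i; rewrite mxE; apply/eqP; rewrite -[_ == _]negbK y0.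
Qed.

Section Duality.
Variable F : fieldType.
Implicit Types (u v y z : 'rV[F]_3) (U : {vspace 'rV[F]_3}) (T : 'M[F]_3).

Lemma mem_dual_line u y : (u \in dual_line y) = ((u *m y^T) 0 0 == 0).
Proof.
rewrite memv_ker lfunE /=; apply/eqP/eqP => [->|uy]; first by rewrite mxE.
by apply/rowP => i; rewrite !ord1 uy mxE.
Qed.

Lemma vline_sub_dual_line u y :
  (<[u]> <= dual_line y)%VS = ((u *m y^T) 0 0 == 0).
Proof. by rewrite -memvE mem_dual_line. Qed.

Lemma delta_mulmx_tr i y : ((delta_mx 0 i : 'rV[F]_3) *m y^T) 0 0 = y 0 i.
Proof. by rewrite -rowE !mxE. Qed.

Lemma dim_dual_line y : y != 0 -> \dim (dual_line y) = 2%N.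
Proof.
move=> /rowN0[i yi]; have := limg_ker_dim (linfun (mulmxr y^T)) {:'rV[F]_3}.
rewrite capfv -/(dual_line y) dimvf (dim_matrix F 1 3 : _ = 3%N) => dimE.
suff im1 : \dim (linfun (mulmxr y^T) @: {:'rV[F]_3})%VS = 1%N.
  by move: dimE; rewrite im1 addn1 => -[].
apply/eqP; rewrite eqn_leq; apply/andP; split.
  by rewrite -[X in (_ <= X)%N](dim_matrix F 1 1) -dimvf; apply/dimvS/subvf.
rewrite lt0n dimv_eq0; apply: contraNneq yi => im0.
have := memv_img (linfun (mulmxr y^T)) (memvf (delta_mx 0 i : 'rV[F]_3)).
by rewrite im0 memv0 lfunE /= -delta_mulmx_tr => /eqP ->; rewrite mxE.
Qed.

Lemma dual_lineZ c y : c != 0 -> dual_line (c *: y) = dual_line y.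
Proof.
move=> c0; apply/vspaceP => u; rewrite !mem_dual_line linearZ /= -scalemxAr mxE.
by rewrite mulf_eq0 (negPf c0).
Qed.

(** The line [dual_line y] contains the vectors [z_j e_i - z_i e_j] orthogonal to
    [z] when it equals [dual_line z], which forces [y] and [z] to be
    proportional. *)
Lemma dual_line_eq y z : y != 0 -> z != 0 ->
  (dual_line y == dual_line z) = (<[y]>%VS == <[z]>%VS).
Proof.
move=> y0 z0; apply/idP/idP => [/eqP yz|/(vline_eqP _ z0)[c c0 ->]]; last first.
  by rewrite dual_lineZ.
have crossE i j : z 0 j * y 0 i = z 0 i * y 0 j.
  have : z 0 j *: delta_mx 0 i - z 0 i *: delta_mx 0 j \in dual_line y.
    by rewrite yz mem_dual_line mulmxBl -!scalemxAl -!rowE !mxE mulrC subrr.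
  by rewrite mem_dual_line mulmxBl -!scalemxAl -!rowE !mxE subr_eq0 => /eqP.
have [i zi] := rowN0 z0; apply/(vline_eqP _ z0).
have yE : y = (y 0 i / z 0 i) *: z.
  by apply/rowP => j; rewrite mxE mulrAC [y 0 i * _]mulrC crossE mulrC mulKf.
exists (y 0 i / z 0 i) => //.
by apply: contraNneq y0 => c0; rewrite yE c0 scale0r.
Qed.

(** A basis of [U] gives two linear equations in three unknowns, which have a
    nonzero solution [y]; then [U] is contained in [dual_line y], of the same
    dimension. *)
Lemma dual_line_surj U : \dim U = 2%N -> exists2 y, y != 0 & U = dual_line y.
Proof.
move=> dU; pose B : 'M[F]_(\dim U, 3) := \matrix_i (vbasis U)`_i.
have y0 : nz_row (kermx B^T) != 0.
  rewrite nz_row_eq0 -mxrank_eq0 mxrank_ker subn_eq0 -ltnNge.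
  by apply: leq_trans (rank_leq_col _) _; rewrite dU.
exists (nz_row (kermx B^T)) => //.
apply/eqP; rewrite eqEdim dim_dual_line // [X in (_ && (_ <= X))%N]dU andbT.
have /sub_kermxP yB := nz_row_sub (kermx B^T).
apply/subvP => u /coord_vbasis ->; apply: memv_suml => i _; apply: memvZ.
rewrite mem_dual_line; have := congr1 (fun M : 'rV_(\dim U) => M 0 i) yB.
rewrite !mxE => {2}<-; apply/eqP/eq_bigr => k _.
by rewrite !mxE mulrC.
Qed.

Lemma change_coords_vline T u : change_coords T <[u]>%VS = <[u *m T]>%VS.
Proof. by rewrite /change_coords limg_line lfunE. Qed.

(** Lines are transformed contragrediently to points. *)
Lemma change_coords_dual_line T y : T \in unitmx ->
  change_coords T (dual_line y) = dual_line (y *m (invmx T)^T).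
Proof.
move=> uT; apply/vspaceP => u; rewrite mem_dual_line trmx_mul trmxK mulmxA.
apply/memv_imgP/idP => [[w wy ->]|uy].
  by rewrite lfunE /= mulmxK // -mem_dual_line.
by exists (u *m invmx T); rewrite ?mem_dual_line // lfunE /= mulmxKV.
Qed.

End Duality.

(** * Triples with entries -1, 0, 1 *)

Definition tvec (t : int * int * int) : 'rV[int]_3 :=
  \row_k [:: t.1.1; t.1.2; t.2]`_k.

Definition digits : seq int := [:: -1; 0; 1].

Definition cube : seq (int * int * int) :=
  [seq t <- [seq (ab, c) | ab <- [seq (a, b) | a <- digits, b <- digits],
                           c <- digits] | t != 0].

Definition dot (t t' : int * int * int) : int :=
  t.1.1 * t'.1.1 + t.1.2 * t'.1.2 + t.2 * t'.2.

(** As [dot t t] counts the nonzero entries of a triple of [cube], the layers 1,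
    2 and 3 correspond to the vertices, edge centers and face centers. *)
Definition layer k : seq (int * int * int) := [seq t <- cube | dot t t == k].

(** For nonzero triples: the first nonzero entry is 1, which selects one triple
    in each pair of opposite ones. *)
Definition normal (t : int * int * int) :=
  if t.1.1 != 0 then t.1.1 == 1 else if t.1.2 != 0 then t.1.2 == 1 else t.2 == 1.

Definition reps := [seq t <- cube | normal t].

Definition rep_of t := if normal t then t else - t.

Definition rep_layer k : seq (int * int * int) := [seq t <- reps | dot t t == k].

Lemma mem_layer k t : (t \in layer k) = (dot t t == k) && (t \in cube).
Proof. exact: mem_filter. Qed.

Lemma mem_rep_layer k t : (t \in rep_layer k) = (dot t t == k) && (t \in reps).
Proof. exact: mem_filter. Qed.

Lemma mem_digits a : (a \in digits) = (`|a| <= 1).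
Proof. by case: a => [[|[|n]]|[|n]]. Qed.

Lemma tvec_inj : injective tvec.
Proof.
move=> [[a b] c] [[a' b'] c'] /rowP e.
by have := (e 0, e 1, e 2); rewrite !mxE /= => -[[-> ->] ->].
Qed.

Lemma tvecD t t' : tvec (t + t') = tvec t + tvec t'.
Proof. by apply/rowP => k; rewrite !mxE; case: k => [[|[|[|]]]]. Qed.

Lemma tvecN t : tvec (- t) = - tvec t.
Proof. by apply/rowP => k; rewrite !mxE; case: k => [[|[|[|]]]]. Qed.

Lemma cubeP t : reflect (tvec t != 0 /\ forall k, tvec t 0 k \in digits) (t \in cube).
Proof.
have tvec0 : tvec 0 = 0.
  by apply/rowP => k; rewrite !mxE; case: k => [[|[|[|]]]].
case: t => [[a b] c]; rewrite mem_filter -(inj_eq tvec_inj) tvec0.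
apply: (iffP andP) => -[-> tD]; split=> //.
  case/allpairsP: tD => -[ab c'] [/allpairsP[[a' b'] [a'D b'D ->]] c'D [-> -> ->]].
  by case=> [[|[|[|]]]] // i; rewrite mxE.
have [[aD bD] cD] : (a \in digits) * (b \in digits) * (c \in digits).
  by have := (tD 0, tD 1, tD 2); rewrite !mxE.
by apply: allpairs_f => //; apply: allpairs_f.
Qed.

(** In the definition of [cube_vectors], the condition [x != 0] is read in the
    group of functions ['I_1 -> 'I_3 -> int]. *)
Lemma cube_vectors_neq0 x : cube_vectors x <-> x != 0 /\ forall i, `|x 0 i| <= 1.
Proof.
split=> -[x0 x1]; split=> //; apply: contraNneq x0 => xE.
  by rewrite xE; apply/eqP/funext => i; apply/funext => j; rewrite mxE.
by apply/eqP/rowP => i; rewrite xE mxE.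
Qed.

Lemma cube_vectorsE : cube_vectors = tvec @` [set` cube].
Proof.
apply/seteqP; split=> [x /cube_vectors_neq0[x0 x1]|_ [t /cubeP[t0 tD] <-]]; last first.
  by apply/cube_vectors_neq0; split=> // i; rewrite -mem_digits.
have xE : tvec (x 0 0, x 0 1, x 0 2) = x.
  by apply/rowP => k; rewrite !mxE; case: k => [[|[|[|]]]] //= i;
    congr (x 0 _); apply: val_inj.
exists (x 0 0, x 0 1, x 0 2) => //=; apply/cubeP; rewrite xE; split => // k.
by rewrite mem_digits.
Qed.

Lemma rep_of_reps t : t \in cube -> rep_of t \in reps.
Proof. by move: t; apply/allP; vm_compute. Qed.

Lemma rep_of_layer k t : t \in layer k -> rep_of t \in rep_layer k.
Proof.
rewrite mem_layer => /andP[/eqP <- tc]; rewrite mem_rep_layer rep_of_reps // andbT.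
by rewrite /rep_of; case: ifP => // _; rewrite /dot /= !mulrNN.
Qed.

Lemma rep_of_id t : t \in reps -> rep_of t = t.
Proof. by rewrite mem_filter /rep_of => /andP[->]. Qed.

Lemma reps_cube t : t \in reps -> t \in cube.
Proof. by rewrite mem_filter => /andP[]. Qed.

Lemma reps_opp t : t \in reps -> - t \notin reps.
Proof. by move: t; apply/allP; vm_compute. Qed.

(** * Counting with explicit lists *)

Lemma card_seq (T : eqType) (s : seq T) : uniq s -> [set` s] #= `I_(size s).
Proof.
case: s => [|x0 s'] us; first by rewrite set_nil II0.
move: (x0 :: s') us => {s'} s us.
have -> : [set` s] = nth x0 s @` `I_(size s).
  apply/seteqP; split=> [x /= xs|_ [i /= i_s <-]]; last exact: mem_nth.
  by exists (index x s); [rewrite /= index_mem|rewrite nth_index].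
by apply: inj_card_eq => i j; rewrite !inE => ? ? /eqP; rewrite nth_uniq // => /eqP.
Qed.

Lemma card_image_seq (T : eqType) U (f : T -> U) (s : seq T) :
  uniq s -> {in s &, injective f} -> f @` [set` s] #= `I_(size s).
Proof.
move=> us fI; apply: card_eq_trans (card_seq us).
by apply: inj_card_eq => x y; rewrite !inE; apply: fI.
Qed.

(** Pairs of labels (of a point and a line) whose scalar product satisfies [P];
    the incidences of a plane are those where it vanishes in the base field. *)
Definition flags (P : pred int) :=
  [seq pq <- [seq (p, q) | p <- reps, q <- reps] | P (dot pq.1 pq.2)].

Lemma mem_flags P p q :
  ((p, q) \in flags P) = [&& p \in reps, q \in reps & P (dot p q)].
Proof.
rewrite mem_filter andbC andbA; congr (_ && _).
by apply/allpairsP/andP => [[[p' q'] /= [? ? [-> ->]]]|[pr qr]]; last exists (p, q).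
Qed.

Lemma flags_uniq P : uniq (flags P).
Proof.
apply: filter_uniq; apply: allpairs_uniq; first by vm_compute.
  by vm_compute.
by case=> ? ? [? ?].
Qed.

(** * Points and lines labelled by triples *)

Section Frame.
Variables (F : fieldType) (A : 'M[F]_3) (s : F).
Hypotheses (nz2 : 2%:R != 0 :> F) (s0 : s != 0) (AAt : A *m A^T = s%:M).

(** The vector with coordinates [t] in the orthogonal basis of the rows of [A];
    it determines the point [fpoint t] and the line [fline t]. *)
Definition fvec t : 'rV[F]_3 := coords_in F (tvec t) *m A.
Definition fpoint t := <[fvec t]>%VS.
Definition fline t := dual_line (fvec t).
Definition fflag pq := (fpoint pq.1, fline pq.2).

Lemma frame_unit : A \in unitmx.
Proof.
suff /mulmx1_unit[] : A *m (s^-1 *: A^T) = 1%:M by [].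
by rewrite -scalemxAr AAt scale_scalar_mx mulVf.
Qed.

Lemma fvecN t : fvec (- t) = - fvec t.
Proof. by rewrite /fvec tvecN /coords_in raddfN mulNmx. Qed.

Lemma fvecD t t' : fvec (t + t') = fvec t + fvec t'.
Proof. by rewrite /fvec tvecD /coords_in raddfD mulmxDl. Qed.

Lemma dot_fvec t t' : (fvec t *m (fvec t')^T) 0 0 = s * (dot t t')%:~R.
Proof.
rewrite /fvec trmx_mul mulmxA -(mulmxA _ A) AAt scalar_mxC -mulmxA mul_scalar_mx mxE.
congr (_ * _); rewrite mxE !big_ord_recl big_ord0 !mxE /= addr0.
by rewrite /dot !rmorphD !rmorphM addrA.
Qed.

Lemma digits_intr_inj : {in digits &, injective (intr : int -> F)}.
Proof.
have opp1 : (-1 == 1 :> F) = false.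
  by apply/negbTE; apply: contraNneq nz2 => e; rewrite -[2%:R]/(1 + 1 : F) -{1}e addNr.
move=> a b; rewrite !inE => /or3P[] /eqP-> /or3P[] /eqP-> //= /eqP;
 by rewrite ?mulr0z ?mulrN1z ?mulr1z ?oppr_eq0 ?oner_eq0 // ?(eq_sym 0)
  ?oppr_eq0 ?oner_eq0 ?(eq_sym 1) ?opp1.
Qed.

Lemma fvec_neq0 t : t \in cube -> fvec t != 0.
Proof.
move=> /cubeP[/rowN0[k tk] tD]; apply: contraNneq tk => t0; apply/eqP.
apply: digits_intr_inj; rewrite ?tD // mulr0z.
have /rowP/(_ k) : coords_in F (tvec t) = 0.
  by apply: (can_inj (mulmxK frame_unit)); rewrite mul0mx.
by rewrite !mxE.
Qed.

Lemma fvec_inj : {in cube &, injective fvec}.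
Proof.
move=> t t' /cubeP[_ tD] /cubeP[_ t'D] /(can_inj (mulmxK frame_unit))/rowP e.
apply/tvec_inj/rowP => k; apply: digits_intr_inj; rewrite ?tD ?t'D //.
by have := e k; rewrite !mxE.
Qed.

(** Two proportional vectors with entries -1, 0, 1 have ratio 1 or -1, as one
    sees at a nonzero entry of the second one. *)
Lemma fpoint_eq_sign t t' : t \in cube -> t' \in cube ->
  fpoint t = fpoint t' -> t = t' \/ t = - t'.
Proof.
move=> tc t'c /eqP/(vline_eqP _ (fvec_neq0 t'c))[c c0]; rewrite scalemxAl => e.
have {}e k : (tvec t 0 k)%:~R = c * (tvec t' 0 k)%:~R.
  have /rowP/(_ k) := can_inj (mulmxK frame_unit) e.
  by rewrite !mxE.
have /cubeP[_ tD] := tc; have /cubeP[/rowN0[k t'k] t'D] := t'c.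
have [cE|cE] : c = 1 \/ c = -1.
- move: (t'D k) (tD k) (e k) t'k; rewrite !inE.
  case/or3P=> /eqP-> /or3P[] /eqP-> //;
    rewrite ?mulr0z ?mulrN1z ?mulr1z ?mulrN ?mulr1 => E _.
  + by left; apply: oppr_inj.
  + by move/eqP: E; rewrite eq_sym oppr_eq0 (negPf c0).
  + by right; rewrite E opprK.
  + by right.
  + by move/eqP: E; rewrite eq_sym (negPf c0).
  + by left.
- left; apply/tvec_inj/rowP => j; apply: digits_intr_inj; rewrite ?tD ?t'D //.
  by rewrite e cE mul1r.
right; apply: tvec_inj; rewrite tvecN; apply/rowP => j; apply: digits_intr_inj.
- by rewrite tD.
- by rewrite mxE; have := t'D j; rewrite !mem_digits normrN.
by rewrite e cE mulN1r [in RHS]mxE rmorphN.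
Qed.

Lemma fpoint_inj : {in reps &, injective fpoint}.
Proof.
move=> t t' tr t'r /fpoint_eq_sign[] //; try exact: reps_cube.
by move=> tE; have := reps_opp t'r; rewrite -tE tr.
Qed.

Lemma fline_eq t t' : t \in cube -> t' \in cube ->
  (fline t == fline t') = (fpoint t == fpoint t').
Proof. by move=> tc t'c; rewrite /fline dual_line_eq ?fvec_neq0. Qed.

Lemma fline_inj : {in reps &, injective fline}.
Proof.
move=> t t' tr t'r /eqP; rewrite fline_eq ?reps_cube // => /eqP.
exact: fpoint_inj.
Qed.

Lemma fflag_inj P : {in flags P &, injective fflag}.
Proof.
move=> [p q] [p' q']; rewrite !mem_flags => /and3P[pr qr _] /and3P[p'r q'r _].
move=> e; congr (_, _); first exact: fpoint_inj (congr1 fst e).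
exact: fline_inj (congr1 snd e).
Qed.

Lemma fpoint_rep_of t : fpoint (rep_of t) = fpoint t.
Proof.
rewrite /rep_of; case: ifP => // _.
by rewrite /fpoint fvecN -scaleN1r vlineZ // oppr_eq0 oner_eq0.
Qed.

Lemma fline_rep_of t : fline (rep_of t) = fline t.
Proof.
rewrite /rep_of; case: ifP => // _.
by rewrite /fline fvecN -scaleN1r dual_lineZ // oppr_eq0 oner_eq0.
Qed.

Lemma fpoint_layer k : fpoint @` [set` layer k] = fpoint @` [set` rep_layer k].
Proof.
apply/seteqP; split=> [_ [t /= tk <-]|_ [t /= tk <-]].
  by exists (rep_of t); [exact: rep_of_layer|exact: fpoint_rep_of].
move: tk; rewrite mem_rep_layer => /andP[tk tr]; exists t; last by [].
by rewrite /= mem_layer tk reps_cube.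
Qed.

(** The scalar [c] absorbs the factors 1/2 and 1/3 of the centroids. *)
Lemma points_of_layer c k : c != 0 ->
  points_of [set c *: fvec t | t in [set` layer k]] = fpoint @` [set` rep_layer k].
Proof.
move=> c0; rewrite -fpoint_layer /points_of image_comp.
by apply: eq_imagel => t _ /=; rewrite vlineZ.
Qed.

Lemma image_cube U (f : int * int * int -> U) :
  (forall t, f (rep_of t) = f t) -> f @` [set` cube] = f @` [set` reps].
Proof.
move=> f_rep; apply/seteqP; split=> [_ [t /= tc <-]|_ [t /= tr <-]].
  by exists (rep_of t); [exact: rep_of_reps|exact: f_rep].
by exists t => //=; apply: reps_cube.
Qed.

Lemma card_rep_layer k :
  fpoint @` [set` rep_layer k] #= `I_(size (rep_layer k)).
Proof.
apply: card_image_seq; first by apply: filter_uniq; apply: filter_uniq; vm_compute.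
by move=> p q; rewrite !mem_rep_layer => /andP[_ pr] /andP[_ qr]; apply: fpoint_inj.
Qed.

Lemma dual_lines_frame : dual_lines (fpoint @` [set` reps]) = fline @` [set` reps].
Proof.
apply/seteqP; split=> [_ [y [y0 [t /= tr e]] <-]|_ [t /= tr <-]].
  exists t => //; apply/eqP; rewrite dual_line_eq ?fvec_neq0 ?reps_cube //.
  exact/eqP.
exists (fvec t) => //; split; first by rewrite fvec_neq0 ?reps_cube.
by exists t.
Qed.

Lemma incidences_frame : incidences (fpoint @` [set` reps]) (fline @` [set` reps]) =
  fflag @` [set` flags (fun d => d%:~R == 0 :> F)].
Proof.
have sE t t' : (fpoint t <= fline t')%VS = ((dot t t')%:~R == 0 :> F).
  by rewrite vline_sub_dual_line dot_fvec mulf_eq0 (negPf s0).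
apply/seteqP; split=> [[p l] [/= [t tr <-] [t' t'r <-] tt']|_ [[t t'] ttf <-]].
  by exists (t, t') => //=; rewrite mem_flags; apply/and3P; split; rewrite -?sE.
have : (t, t') \in flags (fun d => d%:~R == 0 :> F) := ttf.
rewrite mem_flags => /and3P[tr t'r tt']; split=> /=; [by exists t|by exists t'|].
by rewrite sE.
Qed.

End Frame.

(** * Faces of the octahedron *)

Definition axes : seq (int * int * int) := [:: (1, 0, 0); (0, 1, 0); (0, 0, 1)].

(** The vertices on the supporting plane [x . t = 1], that is, the vertices of the
    face whose center is proportional to [x]. *)
Definition supported x := [seq t <- layer 1 | dot t x == 1].

Lemma layer_cube k t : t \in layer k -> t \in cube.
Proof. by rewrite mem_layer => /andP[]. Qed.

Lemma layerN k t : t \in layer k -> - t \in layer k.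
Proof.
rewrite !mem_layer => /andP[/eqP <- /cubeP[t0 tD]]; rewrite {1}/dot /= !mulrNN eqxx.
apply/cubeP; rewrite tvecN oppr_eq0; split=> // k'.
by rewrite mxE mem_digits normrN -mem_digits.
Qed.

Lemma tvec_axes (i : 'I_3) : tvec axes`_i = delta_mx 0 i.
Proof.
by apply/rowP => k; rewrite !mxE; case: i => [[|[|[|]]]] //; case: k => [[|[|[|]]]].
Qed.

Lemma dot_vertex_le1 t x : t \in layer 1 -> x \in cube -> dot t x <= 1.
Proof.
move=> t1 xc.
have /allP/(_ t t1)/allP/(_ x xc) // :
  all (fun t => all (fun x => dot t x <= 1) cube) (layer 1).
by vm_compute.
Qed.

(** Distinct vertices that are not opposite lie on different axes. *)
Lemma vertex_add2 t t' : t \in layer 1 -> t' \in layer 1 -> t != t' -> t != - t' ->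
  t + t' \in layer 2.
Proof.
move=> t1 t'1.
have /allP/(_ t t1)/allP/(_ t' t'1) : all (fun t => all (fun t' =>
  (t != t') ==> (t != - t') ==> (t + t' \in layer 2)) (layer 1)) (layer 1).
  by vm_compute.
by move=> /implyP h tt' tNt'; apply: (implyP (h tt')).
Qed.

Lemma vertex_add3 t t' t'' :
  t \in layer 1 -> t' \in layer 1 -> t'' \in layer 1 ->
  uniq [:: t; t'; t''] -> t != - t' -> t != - t'' -> t' != - t'' ->
  t + t' + t'' \in layer 3.
Proof.
move=> t1 t'1 t''1 u n1 n2 n3.
have /allP/(_ t t1)/allP/(_ t' t'1)/allP/(_ t'' t''1) :
  all (fun t => all (fun t' => all (fun t'' =>
    [&& uniq [:: t; t'; t''], t != - t', t != - t'' & t' != - t''] ==>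
    (t + t' + t'' \in layer 3)) (layer 1)) (layer 1)) (layer 1).
  by vm_compute.
by move/implyP; apply; rewrite u n1 n2.
Qed.

(** The face with center direction [x] has exactly the signed axes occurring in
    [x] as vertices. *)
Lemma supported2 x : x \in layer 2 ->
  exists t t', [/\ supported x = [:: t; t'], t != t' & x = t + t'].
Proof.
move=> x2; have : (size (supported x) == 2)%N && (foldr +%R 0 (supported x) == x).
  by move: x x2; apply/allP; vm_compute.
have : uniq (supported x) by apply: filter_uniq; vm_compute.
case: (supported x) => [|t [|t' [|]]] //=; rewrite inE andbT => tt'.
by rewrite addr0 => /eqP xE; exists t, t'.
Qed.

Lemma supported3 x : x \in layer 3 ->
  exists t t' t'', [/\ supported x = [:: t; t'; t''], uniq [:: t; t'; t''] &
    x = t + t' + t''].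
Proof.
move=> x3; have : (size (supported x) == 3)%N && (foldr +%R 0 (supported x) == x).
  by move: x x3; apply/allP; vm_compute.
have : uniq (supported x) by apply: filter_uniq; vm_compute.
case: (supported x) => [|t [|t' [|t'' []]]] //= u.
by rewrite addr0 addrA => /eqP xE; exists t, t', t''.
Qed.

Section Octahedron.
Variables (R : realType) (A : 'M[R]_3) (s : R).
Hypotheses (s_gt0 : 0 < s) (AAt : A *m A^T = s%:M).
Local Notation vec := (fvec A).
Local Notation V := (vec @` [set` layer 1]).

Let nz2 : 2%:R != 0 :> R. Proof. by rewrite pnatr_eq0. Qed.
Let s0 : s != 0. Proof. by rewrite gt_eqF. Qed.

Lemma octahedron_vertices : [set v | exists i, v = row i A \/ v = - row i A] = V.
Proof.
have vec_axes (i : 'I_3) : vec axes`_i = row i A.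
  by rewrite rowE /fvec tvec_axes /coords_in map_delta_mx.
have axes1 (i : 'I_3) : axes`_i \in layer 1 by case: i => [[|[|[|]]]].
apply/seteqP; split=> [v [i [->|->]]|_ [t /= t1 <-]].
- by exists axes`_i; [exact: axes1|exact: vec_axes].
- by exists (- axes`_i); [exact/layerN/axes1|rewrite fvecN vec_axes].
have : (t \in axes) || (- t \in axes) by move: t t1; apply/allP; vm_compute.
case/orP=> /(nthP 0)[i i3 tE]; exists (Ordinal i3); rewrite -vec_axes tE.
  by left.
by right; rewrite fvecN opprK.
Qed.

Lemma vertex_inj t t' : t \in layer 1 -> t' \in layer 1 -> vec t = vec t' -> t = t'.
Proof. by move=> /layer_cube tc /layer_cube t'c; apply: (fvec_inj nz2 s0 AAt). Qed.

(** A face [S] with two antipodal vertices lies on a plane [c . v = 0].  Every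
    vertex [v] and its opposite satisfy [c . v <= 0], so all six vertices are
    in [S]; the hypotheses bound their number by [size ts]. *)
Lemma face_no_antipodes S t ts : spans_face V S ->
  (forall t', t' \in layer 1 -> S (vec t') -> t' \in ts) -> (size ts < 6)%N ->
  S (vec t) -> S (- vec t) -> False.
Proof.
move=> [c [m [le_m ->]]] Sts ts6 [_ tm] [_]; rewrite mulNmx mxE tm => Nm.
(* opposite vertices have opposite scalar products with c, so m = - m *)
have m0 : m = 0.
  by apply/eqP; rewrite -[_ == _](mulrn_eq0 m 2) mulr2n -{1}Nm addNr.
suff : (size (layer 1) <= size ts)%N by rewrite leqNgt => /negP; apply.
apply: uniq_leq_size => [|t' t'1]; first by vm_compute.
apply: Sts => //; split; first by exists t'.
have le1 := le_m (vec t'); have le2 := le_m (vec (- t')).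
apply/le_anti; rewrite le1 /=; last by exists t'.
have := le2; rewrite fvecN mulNmx mxE m0 oppr_le0; apply.
by exists (- t'); [exact: layerN|exact: fvecN].
Qed.

(** The supporting plane is orthogonal to [vec x]; dividing by [s] normalizes the
    scalar products to those of the triples. *)
Lemma supported_spans_face x : x \in cube ->
  spans_face V [set vec t | t in [set` supported x]].
Proof.
move=> xc; exists (s^-1 *: vec x), 1.
have dotE t : (vec t *m (s^-1 *: vec x)^T) 0 0 = (dot t x)%:~R.
  by rewrite linearZ /= -scalemxAr mxE (dot_fvec AAt) mulKf.
split=> [_ [t /= t1 <-]|]; first by rewrite dotE -[1]/(1%:~R) ler_int dot_vertex_le1.
apply/seteqP; split=> [_ [t /= + <-]|_ [[t /= t1 <-] +]].
  rewrite mem_filter => /andP[/eqP t1 tl]; split; first by exists t.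
  by rewrite dotE t1.
rewrite dotE => /eqP; rewrite -[1]/(1%:~R) eqr_int => tx.
by exists t => //=; rewrite mem_filter tx.
Qed.

Lemma edge_centersE : edge_centers V = [set 2^-1 *: vec x | x in [set` layer 2]].
Proof.
apply/seteqP; split=> [_ [u [v [uv face ->]]]|_ [x /= x2 <-]]; last first.
  have [t [t' [xE tt' ->]]] := supported2 x2.
  exists (vec t), (vec t'); split; last by rewrite fvecD.
    have mem y : y \in [:: t; t'] -> y \in layer 1.
      by rewrite -xE mem_filter => /andP[].
    by apply: contra_neq tt'; apply: vertex_inj; apply: mem; rewrite !inE eqxx ?orbT.
  have := supported_spans_face (layer_cube x2); rewrite xE.
  congr spans_face; apply/seteqP; split=> [_ [y yt <-]|_ [->|->]].
  - by move: (yt : y \in [:: t; t']); rewrite !inE => /orP[] /eqP->; [left|right].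
  - by exists t; rewrite //= mem_head.
  - by exists t'; rewrite //= !inE eqxx orbT.
have [c [m [_ SE]]] := face.
have inV w : [set u; v] w -> V w by rewrite SE => -[].
have [t /= t1 tE] := inV u (or_introl erefl).
have [t' /= t'1 t'E] := inV v (or_intror erefl).
have tt' : t != t' by apply: contra_neq uv => tt'; rewrite -tE -t'E tt'.
have tNt' : t != - t'.
  apply/eqP => tN; apply: (face_no_antipodes (t := t) (ts := [:: t; t']) face) => //.
  - move=> y y1 [|] /= e; rewrite !inE; apply/orP; [left|right]; apply/eqP.
      by apply: vertex_inj => //; rewrite e.
    by apply: vertex_inj => //; rewrite e.
  - by left.
  - by right; rewrite -fvecN tN opprK.
by exists (t + t'); rewrite /= ?vertex_add2 // fvecD tE t'E.
Qed.

Lemma face_centersE : face_centers V = [set 3^-1 *: vec x | x in [set` layer 3]].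
Proof.
apply/seteqP; split=> [_ [u [v [w [uvw face ->]]]]|_ [x /= x3 <-]]; last first.
  have [t [t' [t'' [xE tt' ->]]]] := supported3 x3.
  exists (vec t), (vec t'), (vec t''); split; last by rewrite !fvecD.
    rewrite -[[:: vec t; _; _]]/(map vec [:: t; t'; t'']) map_inj_in_uniq //.
    have mem y : y \in [:: t; t'; t''] -> y \in layer 1.
      by rewrite -xE mem_filter => /andP[].
    by move=> y z /mem y1 /mem z1; apply: vertex_inj.
  have := supported_spans_face (layer_cube x3); rewrite xE.
  congr spans_face; apply/seteqP; split=> [_ [y yt <-]|_ [[->|->]|->]].
  - move: (yt : y \in [:: t; t'; t'']); rewrite !inE.
    by case/or3P=> /eqP->; [left; left|left; right|right].
  - by exists t; rewrite //= mem_head.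
  - by exists t'; rewrite //= !inE eqxx orbT.
  - by exists t''; rewrite //= !inE eqxx !orbT.
have [c [m [_ SE]]] := face.
have inV y : [set u; v; w] y -> V y by rewrite SE => -[].
have [t /= t1 tE] := inV u (or_introl (or_introl erefl)).
have [t' /= t'1 t'E] := inV v (or_introl (or_intror erefl)).
have [t'' /= t''1 t''E] := inV w (or_intror erefl).
have noN y z : [set u; v; w] (vec y) -> [set u; v; w] (vec z) -> y != - z.
  move=> Sy Sz; apply/eqP => yN.
  apply: (face_no_antipodes (t := y) (ts := [:: t; t'; t'']) face) => //.
    move=> x x1 [[|]|] /= e; rewrite !inE; apply/or3P;
      [apply: Or31|apply: Or32|apply: Or33]; apply/eqP;
      by apply: vertex_inj => //; rewrite e.
  by rewrite -fvecN yN opprK.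
have St : [set u; v; w] (vec t) by left; left.
have St' : [set u; v; w] (vec t') by left; right.
have St'' : [set u; v; w] (vec t'') by right.
exists (t + t' + t''); last by rewrite !fvecD tE t'E t''E.
apply: vertex_add3 => //; try exact: noN.
move: uvw; rewrite -tE -t'E -t''E -[[:: _; _; _]]/(map vec [:: t; t'; t'']).
exact: map_uniq.
Qed.

End Octahedron.

(** * The cube vectors over a field *)

Lemma fvec1 (F : fieldType) t : fvec (1%:M : 'M[F]_3) t = coords_in F (tvec t).
Proof. exact: mulmx1. Qed.

Lemma frame1 (F : fieldType) : (1%:M : 'M[F]_3) *m 1%:M^T = 1%:M.
Proof. by rewrite trmx1 mulmx1. Qed.

Lemma points_cube (F : fieldType) :
  [set <[coords_in F x]>%VS | x in cube_vectors] =
  fpoint (1%:M : 'M[F]_3) @` [set` reps].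
Proof.
rewrite cube_vectorsE image_comp -(image_cube (fpoint_rep_of _)).
by apply: eq_imagel => t _; rewrite /= /fpoint fvec1.
Qed.

Lemma lines_cube (F : fieldType) :
  [set dual_line (coords_in F y) | y in cube_vectors] =
  fline (1%:M : 'M[F]_3) @` [set` reps].
Proof.
rewrite cube_vectorsE image_comp -(image_cube (fline_rep_of _)).
by apply: eq_imagel => t _; rewrite /= /fline fvec1.
Qed.

Lemma cube_vectors_nonzeroE :
  [set x | cube_vectors x /\ forall i, x 0 i != 0] = tvec @` [set` layer 3].
Proof.
have layer3 t : t \in cube -> (t \in layer 3) = [&& t.1.1 != 0, t.1.2 != 0 & t.2 != 0].
  by move=> tc; apply/eqP; move: t tc; apply/allP; vm_compute.
rewrite cube_vectorsE; apply/seteqP; split=> [_ [[t /= tc <-] tn0]|_ [t /= t3 <-]].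
  exists t => //=; rewrite layer3 //.
  by have := (tn0 0, tn0 1, tn0 2); rewrite !mxE => -[[-> ->] ->].
have tc := layer_cube t3; split; first by exists t.
move: t3; rewrite layer3 // => /and3P[? ? ?] i.
by rewrite !mxE; case: i => [[|[|[|]]]].
Qed.

Lemma points_cube_nonzero (F : fieldType) :
  [set <[coords_in F x]>%VS
    | x in [set x | cube_vectors x /\ forall i, x 0 i != 0]] =
  fpoint (1%:M : 'M[F]_3) @` [set` rep_layer 3].
Proof.
rewrite cube_vectors_nonzeroE image_comp -[RHS]fpoint_layer.
by apply: eq_imagel => t _; rewrite /= /fpoint fvec1.
Qed.

Lemma eq_flags (P Q : pred int) : P =1 Q -> flags P = flags Q.
Proof. by move=> PQ; apply: eq_filter => pq /=; rewrite PQ. Qed.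

(** Scalar products of triples are at most 3 in absolute value, and the bound is
    reached only by opposite or equal triples without zero entries. *)
Lemma flags_diff p q : p \in reps -> q \in reps ->
  (3 %| dot p q)%Z && (dot p q != 0) = (p == q) && (p \in rep_layer 3).
Proof.
move=> pr qr; apply/eqP; move: q qr; apply/allP; move: p pr; apply/allP.
by vm_compute.
Qed.

(** * The projective plane over F_3 *)

Section ModThree.
Local Notation F3 := 'F_3.
Local Notation I3 := (1%:M : 'M[F3]_3).

Lemma nz2_F3 : 2%:R != 0 :> F3. Proof. by []. Qed.

Lemma digit_F3 (z : F3) : exists2 a, a \in digits & z = a%:~R.
Proof.
case: z => [[|[|[|//]]] i]; [exists 0|exists 1|exists (-1)] => //; exact: val_inj.
Qed.

Lemma fvec_F3_surj (v : 'rV[F3]_3) : v != 0 -> exists2 t, t \in cube & v = fvec I3 t.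
Proof.
move=> v0; have [a aD aE] := digit_F3 (v 0 0); have [b bD bE] := digit_F3 (v 0 1).
have [c cD cE] := digit_F3 (v 0 2); exists (a, b, c); last first.
  rewrite fvec1; apply/rowP => k; rewrite !mxE; case: k => [[|[|[|]]]] //= i;
    by rewrite -?aE -?bE -?cE; congr (v 0 _); apply: val_inj.
rewrite mem_filter; apply/andP; split; last by apply: allpairs_f => //; apply: allpairs_f.
apply: contraNneq v0 => -[a0 b0 c0]; apply/eqP/rowP => k; rewrite mxE.
rewrite a0 in aE; rewrite b0 in bE; rewrite c0 in cE.
by case: k => [[|[|[|]]]] //= i; [rewrite -[RHS]aE|rewrite -[RHS]bE|rewrite -[RHS]cE];
  congr (v 0 _); apply: val_inj.
Qed.

Lemma proj_points_F3 : @proj_points F3 = fpoint I3 @` [set` reps].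
Proof.
rewrite -(image_cube (fpoint_rep_of _)); apply/seteqP; split=> [U /= dU|_ [t /= tc <-]].
  have v0 : vpick U != 0 by rewrite vpick0 -dimv_eq0 dU.
  have [t tc vE] := fvec_F3_surj v0; exists t => //.
  apply/eqP; rewrite /fpoint -vE eqEdim dim_vline v0 dU andbT -memvE.
  exact: memv_pick.
by rewrite /proj_points /= dim_vline (fvec_neq0 nz2_F3 (oner_neq0 _) (frame1 _)).
Qed.

Lemma proj_lines_F3 : @proj_lines F3 = fline I3 @` [set` reps].
Proof.
rewrite -(image_cube (fline_rep_of _)); apply/seteqP; split=> [U /= dU|_ [t /= tc <-]].
  have [y y0 ->] := dual_line_surj dU.
  by have [t tc ->] := fvec_F3_surj y0; exists t.
by rewrite /proj_lines /= dim_dual_line // (fvec_neq0 nz2_F3 (oner_neq0 _) (frame1 _)).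
Qed.

Lemma flags_F3 : flags (fun d => d%:~R == 0 :> F3) = flags (dvdz 3).
Proof. by apply: eq_flags => d; rewrite -(dvdz_pcharf (pchar_Fp (isT : prime 3))). Qed.

Lemma incidences_F3 :
  incidences (@proj_points F3) (@proj_lines F3) = fflag I3 @` [set` flags (dvdz 3)].
Proof.
rewrite proj_points_F3 proj_lines_F3.
by rewrite (incidences_frame (oner_neq0 _) (frame1 _)) flags_F3.
Qed.

End ModThree.

(** * Reduction modulo 3 of the octahedron *)

Section Reduction.
Variables (R : realType) (A : 'M[R]_3) (s : R).
Hypotheses (s_gt0 : 0 < s) (AAt : A *m A^T = s%:M).
Local Notation V := (fvec A @` [set` layer 1]).
Local Notation X := (fpoint A @` [set` reps]).
Local Notation Xd := (fline A @` [set` reps]).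
Local Notation B := (1%:M : 'M[R]_3).
Local Notation I3 := (1%:M : 'M['F_3]_3).

Let nz2 : 2%:R != 0 :> R. Proof. by rewrite pnatr_eq0. Qed.
Let s0 : s != 0. Proof. by rewrite gt_eqF. Qed.

Lemma points_of_vertices : points_of V = fpoint A @` [set` rep_layer 1].
Proof. by rewrite -fpoint_layer /points_of image_comp. Qed.

Lemma points_of_edge_centers :
  points_of (edge_centers V) = fpoint A @` [set` rep_layer 2].
Proof. by rewrite (edge_centersE s_gt0 AAt) points_of_layer // invr_eq0. Qed.

Lemma points_of_face_centers :
  points_of (face_centers V) = fpoint A @` [set` rep_layer 3].
Proof. by rewrite (face_centersE s_gt0 AAt) points_of_layer // invr_eq0 pnatr_eq0. Qed.

Lemma octahedron_pointsE : octahedron_points V = X.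
Proof.
rewrite /octahedron_points /points_of !image_setU -!/(points_of _).
rewrite points_of_vertices points_of_edge_centers points_of_face_centers.
rewrite -!image_setU; congr (_ @` _); apply/seteqP; split=> t /=.
  by rewrite !mem_rep_layer => -[[|]|] /andP[].
have : t \in reps -> [|| t \in rep_layer 1, t \in rep_layer 3 | t \in rep_layer 2].
  by move: t; apply/allP; vm_compute.
by move=> h /h /or3P[]; [left; left|left; right|right].
Qed.

Lemma invmx_similarity : invmx A *m (invmx A)^T = s^-1%:M.
Proof.
have invE : invmx A = s^-1 *: A^T.
  rewrite -[RHS](mulKmx (frame_unit s0 AAt)) -scalemxAr AAt scale_scalar_mx mulVf //.
  by rewrite mulmx1.
rewrite {2}invE linearZ /= trmxK -scalemxAr mulVmx ?(frame_unit s0 AAt) //.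
by rewrite scale_scalar_mx mulr1.
Qed.

(** The change of coordinates [invmx A] takes the rows of [A] to the standard
    basis, so the frame [A] to the frame 1. *)
Lemma change_coords_fpoint t : change_coords (invmx A) (fpoint A t) = fpoint B t.
Proof. by rewrite change_coords_vline mulmxK ?(frame_unit s0 AAt) // /fpoint fvec1. Qed.

(** Lines are moved by the transpose of [A] rather than by its inverse; as [A] is
    a similarity, the two agree up to the scalar [s]. *)
Lemma change_coords_fline t : change_coords (invmx A) (fline A t) = fline B t.
Proof.
rewrite change_coords_dual_line ?unitmx_inv ?(frame_unit s0 AAt) // invmxK /fvec.
by rewrite -mulmxA AAt mul_mx_scalar dual_lineZ // /fline fvec1.
Qed.

(** The label of a point of the octahedron is read off by a partial inverse of
    [fpoint A], with default 0 elsewhere; the image is the point over 'F_3 with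
    the same label. *)
Definition reduce_point p := fpoint I3 ('pinv_(fun=> 0) [set` reps] (fpoint A) p).

Definition reduce_line l := fline I3 ('pinv_(fun=> 0) [set` reps] (fline A) l).

Lemma reduce_pointE t : t \in reps -> reduce_point (fpoint A t) = fpoint I3 t.
Proof.
move=> tr; rewrite /reduce_point pinvKV ?inE // => x y.
by rewrite !inE; apply: (fpoint_inj nz2 s0 AAt).
Qed.

Lemma reduce_lineE t : t \in reps -> reduce_line (fline A t) = fline I3 t.
Proof.
move=> tr; rewrite /reduce_line pinvKV ?inE // => x y.
by rewrite !inE; apply: (fline_inj nz2 s0 AAt).
Qed.

Lemma reduce_pointZ c t : c != 0 -> t \in cube ->
  reduce_point <[c *: fvec A t]>%VS = fpoint I3 (rep_of t).
Proof.
move=> c0 tc; rewrite (vlineZ _ c0); have := reduce_pointE (rep_of_reps tc).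
by rewrite (fpoint_rep_of A).
Qed.

Lemma reduce_lineZ c t : c != 0 -> t \in cube ->
  reduce_line (dual_line (c *: fvec A t)) = fline I3 (rep_of t).
Proof.
move=> c0 tc; rewrite (dual_lineZ _ c0); have := reduce_lineE (rep_of_reps tc).
by rewrite (fline_rep_of A).
Qed.

Lemma reduce_point_coords p x : X p -> cube_vectors x ->
  change_coords (invmx A) p = <[coords_in R x]>%VS ->
  reduce_point p = <[coords_in 'F_3 x]>%VS.
Proof.
rewrite cube_vectorsE => -[t /= tr <-] [t' /= t'c <-].
rewrite change_coords_fpoint -fvec1 -/(fpoint _ t') => e.
have -> : t = rep_of t'.
  apply: (fpoint_inj nz2 (oner_neq0 _) (frame1 R) tr (rep_of_reps t'c)).
  by rewrite fpoint_rep_of.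
by rewrite (reduce_pointE (rep_of_reps t'c)) fpoint_rep_of /fpoint fvec1.
Qed.

Lemma reduce_line_coords l y : Xd l -> cube_vectors y ->
  change_coords (invmx A) l = dual_line (coords_in R y) ->
  reduce_line l = dual_line (coords_in 'F_3 y).
Proof.
rewrite cube_vectorsE => -[t /= tr <-] [t' /= t'c <-].
rewrite change_coords_fline -fvec1 -/(fline _ t') => e.
have -> : t = rep_of t'.
  apply: (fline_inj nz2 (oner_neq0 _) (frame1 R) tr (rep_of_reps t'c)).
  by rewrite fline_rep_of.
by rewrite (reduce_lineE (rep_of_reps t'c)) fline_rep_of /fline fvec1.
Qed.

Lemma reduce_point_bij : set_bij X (@proj_points 'F_3) reduce_point.
Proof.
have -> : @proj_points 'F_3 = reduce_point @` X.
  rewrite proj_points_F3 image_comp; apply: eq_imagel => t tr.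
  by rewrite /= reduce_pointE.
apply: inj_bij => _ _ /set_mem[t /= tr <-] /set_mem[t' /= t'r <-].
rewrite (reduce_pointE tr) (reduce_pointE t'r) => e.
by rewrite (fpoint_inj nz2_F3 (oner_neq0 _) (frame1 _) tr t'r e).
Qed.

Lemma reduce_line_bij : set_bij Xd (@proj_lines 'F_3) reduce_line.
Proof.
have -> : @proj_lines 'F_3 = reduce_line @` Xd.
  rewrite proj_lines_F3 image_comp; apply: eq_imagel => t tr.
  by rewrite /= reduce_lineE.
apply: inj_bij => _ _ /set_mem[t /= tr <-] /set_mem[t' /= t'r <-].
rewrite (reduce_lineE tr) (reduce_lineE t'r) => e.
by rewrite (fline_inj nz2_F3 (oner_neq0 _) (frame1 _) tr t'r e).
Qed.

Lemma incidences_octahedron : incidences X Xd = fflag A @` [set` flags (pred1 0)].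
Proof.
rewrite (incidences_frame s0 AAt) (@eq_flags _ (pred1 0)) // => d /=.
by rewrite intr_eq0.
Qed.

Lemma reduce_incidences :
  [set (reduce_point pl.1, reduce_line pl.2) | pl in incidences X Xd] =
  fflag I3 @` [set` flags (pred1 0)].
Proof.
rewrite incidences_octahedron image_comp; apply: eq_imagel => -[p q] /=.
by rewrite mem_flags => /and3P[pr qr _]; rewrite (reduce_pointE pr) (reduce_lineE qr).
Qed.

(** The face centers come in opposite pairs, with the same flag modulo 3, whose
    point and line have the same label. *)
Lemma reduce_face_flags :
  [set (reduce_point <[v]>%VS, reduce_line (dual_line v)) | v in face_centers V] =
  (fun p => fflag I3 (p, p)) @` [set` rep_layer 3].
Proof.
have n3 : 3^-1 != 0 :> R by rewrite invr_eq0 pnatr_eq0.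
have redE t : t \in layer 3 ->
    (reduce_point <[3^-1 *: fvec A t]>%VS, reduce_line (dual_line (3^-1 *: fvec A t)))
    = fflag I3 (rep_of t, rep_of t).
  move=> t3; have tc := layer_cube t3.
  by rewrite (reduce_pointZ n3 tc) (reduce_lineZ n3 tc).
rewrite (face_centersE s_gt0 AAt) image_comp; apply/seteqP.
split=> [_ [t /= t3 <-]|_ [t /= t3 <-]].
  by exists (rep_of t); [exact: rep_of_layer|rewrite /= (redE t t3)].
move: t3; rewrite mem_rep_layer => /andP[t3 tr].
have tl : t \in layer 3 by rewrite mem_layer t3 reps_cube.
by exists t; last by rewrite /= (redE t tl) rep_of_id.
Qed.

Lemma extra_incidences :
  fflag I3 @` [set` flags (dvdz 3)] `\` fflag I3 @` [set` flags (pred1 0)] =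
  (fun p => fflag I3 (p, p)) @` [set` rep_layer 3].
Proof.
apply/seteqP; split=> [_ [[[p q] /= + <-] notJ]|_ [p /= p3 <-]].
  rewrite mem_flags => /and3P[pr qr pq]; have {}pq : (3 %| dot p q)%Z := pq.
  have /andP[/eqP <- p3] : (p == q) && (p \in rep_layer 3).
    rewrite -flags_diff // pq /=; apply: contra_notN notJ => pq0.
    by exists (p, q); rewrite //= mem_flags pr qr.
  by exists p.
have pr : p \in reps by move: p3; rewrite mem_rep_layer => /andP[].
have /andP[p_3 p_0] : (3 %| dot p p)%Z && (dot p p != 0) by rewrite flags_diff // eqxx.
split; first by exists (p, p); rewrite //= mem_flags pr.
case=> -[p' q'] /= + e; rewrite mem_flags => /and3P[p'r q'r /eqP].
have pE : fpoint I3 p' = fpoint I3 p := congr1 fst e.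
have qE : fline I3 q' = fline I3 p := congr1 snd e.
rewrite (fpoint_inj nz2_F3 (oner_neq0 _) (frame1 _) p'r pr pE).
rewrite (fline_inj nz2_F3 (oner_neq0 _) (frame1 _) q'r pr qE).
by move=> pp0; rewrite pp0 in p_0.
Qed.

Lemma card_face_flags : (fun p => fflag I3 (p, p)) @` [set` rep_layer 3] #= `I_4.
Proof.
apply: (card_image_seq (s := rep_layer 3)); first by vm_compute.
move=> p q; rewrite !mem_rep_layer => /andP[_ pr] /andP[_ qr] e.
have pE : fpoint I3 p = fpoint I3 q := congr1 fst e.
exact: (fpoint_inj nz2_F3 (oner_neq0 _) (frame1 _) pr qr pE).
Qed.

End Reduction.

(** * The octahedron and the plane of order 3 *)

Theorem mainTheorem8 (R : realType) (V : set 'rV[R]_3)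
    (hV : centered_regular_octahedron V) :
  let X := octahedron_points V in
  let Xd := dual_lines X in
  let FP := points_of (face_centers V) in
  [/\ points_of V #= `I_3, FP #= `I_4 & points_of (edge_centers V) #= `I_6] /\
  [/\ X `<=` @proj_points R, X #= `I_13, Xd `<=` @proj_lines R & Xd #= `I_13] /\
  incidences X Xd #= `I_48 /\
  cube_vectors #= `I_26 /\
  exists T : 'M[R]_3,
    [/\ is_similarity T,
        change_coords T @` X = [set <[coords_in R x]>%VS | x in cube_vectors],
        change_coords T @` Xd =
          [set dual_line (coords_in R y) | y in cube_vectors] &
        change_coords T @` FP =
          [set <[coords_in R x]>%VS
             | x in [set x | cube_vectors x /\ forall i, x 0 i != 0]]] /\
    exists (rho rhod : {vspace 'rV[R]_3} -> {vspace 'rV['F_3]_3}),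
      [/\ forall p x, X p -> cube_vectors x ->
            change_coords T p = <[coords_in R x]>%VS ->
            rho p = <[coords_in 'F_3 x]>%VS,
          forall l y, Xd l -> cube_vectors y ->
            change_coords T l = dual_line (coords_in R y) ->
            rhod l = dual_line (coords_in 'F_3 y),
          set_bij X (@proj_points 'F_3) rho &
          set_bij Xd (@proj_lines 'F_3) rhod] /\
      let I3 := incidences (@proj_points 'F_3) (@proj_lines 'F_3) in
      let J := [set (rho pl.1, rhod pl.2) | pl in incidences X Xd] in
      let K := [set (rho <[v]>%VS, rhod (dual_line v)) | v in face_centers V] in
      [/\ I3 #= `I_52, J `<=` I3, I3 `\` J = K & K #= `I_4].
Proof.
move=> X Xd FP; case: hV => A [s s_gt0 AAt] VE.
have nz2 : 2%:R != 0 :> R by rewrite pnatr_eq0.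
have s0 : s != 0 by rewrite gt_eqF.
have cardL := card_rep_layer nz2 s0 AAt.
have {}VE : V = fvec A @` [set` layer 1] by rewrite VE octahedron_vertices.
have XE : X = fpoint A @` [set` reps] by rewrite /X VE (octahedron_pointsE s_gt0 AAt).
have XdE : Xd = fline A @` [set` reps].
  by rewrite /Xd XE (dual_lines_frame nz2 s0 AAt).
have FPE : FP = fpoint A @` [set` rep_layer 3].
  by rewrite /FP VE (points_of_face_centers s_gt0 AAt).
have uniq_reps : uniq reps by vm_compute.
split.
  rewrite FPE VE points_of_vertices (points_of_edge_centers s_gt0 AAt).
  by split; [exact: (cardL 1)|exact: (cardL 3)|exact: (cardL 2)].
split.
  rewrite XdE XE; split.
  - move=> _ [t /= /reps_cube tc <-].
    by rewrite /proj_points /= dim_vline (fvec_neq0 nz2 s0 AAt).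
  - exact: (card_image_seq uniq_reps (fpoint_inj nz2 s0 AAt)).
  - move=> _ [t /= /reps_cube tc <-].
    by rewrite /proj_lines /= dim_dual_line // (fvec_neq0 nz2 s0 AAt).
  - exact: (card_image_seq uniq_reps (fline_inj nz2 s0 AAt)).
split.
  rewrite XdE XE (incidences_octahedron s_gt0 AAt).
  apply: (card_image_seq (s := flags (pred1 0))); first exact: flags_uniq.
  exact: (fflag_inj nz2 s0 AAt).
split.
  rewrite cube_vectorsE; apply: (card_image_seq (s := cube)); first by vm_compute.
  by move=> t t' _ _; apply: tvec_inj.
exists (invmx A); split.
  split.
  - by exists s^-1; rewrite ?invr_gt0 // (invmx_similarity s_gt0 AAt).
  - rewrite points_cube XE image_comp; apply: eq_imagel => t _.
    exact: (change_coords_fpoint s_gt0 AAt).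
  - rewrite lines_cube XdE image_comp; apply: eq_imagel => t _.
    exact: (change_coords_fline s_gt0 AAt).
  - rewrite points_cube_nonzero FPE image_comp; apply: eq_imagel => t _.
    exact: (change_coords_fpoint s_gt0 AAt).
exists (reduce_point A), (reduce_line A); split.
  rewrite XdE XE; split.
  - exact: (reduce_point_coords s_gt0 AAt).
  - exact: (reduce_line_coords s_gt0 AAt).
  - exact: (reduce_point_bij s_gt0 AAt).
  - exact: (reduce_line_bij s_gt0 AAt).
move=> I3 J K.
have I3E : I3 = fflag 1%:M @` [set` flags (dvdz 3)] := incidences_F3.
have JE : J = fflag 1%:M @` [set` flags (pred1 0)].
  by rewrite /J XdE XE (reduce_incidences s_gt0 AAt).
have KE : K = (fun p => fflag 1%:M (p, p)) @` [set` rep_layer 3].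
  by rewrite /K VE; exact: (reduce_face_flags s_gt0 AAt).
split.
- rewrite I3E; apply: (card_image_seq (s := flags (dvdz 3))); first exact: flags_uniq.
  exact: (fflag_inj nz2_F3 (oner_neq0 _) (frame1 _)).
- rewrite I3E JE => _ [[p q] /= + <-]; rewrite mem_flags => /and3P[pr qr /eqP pq0].
  by exists (p, q); rewrite //= mem_flags pr qr pq0.
- by rewrite I3E JE KE; exact: extra_incidences.
- by rewrite KE; exact: card_face_flags.
Qed.
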